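(* Let $n\geq 1$ and $d\geq 0$. Then \[ \mathsf{ITC}_{n,d} = \{[(d),(n)]\} \cup \bigcup_{k\geq 2}\left\{ [(b_1,\ldots,b_k),(a_1,\ldots,a_k)] \;:\; \begin{array}{l} b_1,\ldots,b_k\geq 0,\ b_1+\cdots+b_k=d,\\ a_1,\ldots,a_k\geq 0,\ a_1+\cdots+a_k=n,\\ a_1,\ldots,a_{k-1}>0,\ \text{and } b_k+a_k>0\end{array}\right\}. \]
   Context: The complete split graph $S_{n,d}$ has vertices $s,v_1,\ldots,v_n$ (the clique part together with the sink $s$) and $w_1,\ldots,w_d$ (the independent part); any two distinct vertices among $s,v_1,\ldots,v_n$ are adjacent, each $w_j$ is adjacent to every one of $s,v_1,\ldots,v_n$, and no two $w_j$'s are adjacent. Thus $\deg(v_i)=n+d$ and $\deg(w_j)=n+1$. The vertex $s$ is the sink. A configuration assigns a non-negative integer (number of grains) to each non-sink vertex; it is written $(c(v_1),\ldots,c(v_n);c(w_1),\ldots,c(w_d))$. A non-sink vertex $v$ is unstable if $c(v)\geq\deg(v)$; toppling a vertex $v$ removes $\deg(v)$ grains from $v$ (if $v\neq s$) and adds one grain to each non-sink neighbour of $v$ (the sink absorbs grains). A configuration is stable if every non-sink vertex is stable. A stable configuration $c$ is recurrent iff there is an ordering $s=u_0,u_1,\ldots,u_{n+d}$ of all vertices such that, starting from $c$ and toppling $u_0,\ldots,u_{i-1}$ in turn, the vertex $u_i$ is unstable for every $i\geq 1$. $\mathsf{SortedRec}(S_{n,d})$ is the set of recurrent configurations with $c(v_1)\geq\cdots\geq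 c(v_n)$ and $c(w_1)\geq\cdots\geq c(w_d)$. ITC toppling of $c\in\mathsf{SortedRec}(S_{n,d})$: topple the sink; then for $i=1,2,\ldots$: let $Q'_i$ be the set of currently unstable independent vertices and topple all of them simultaneously; then let $P'_i$ be the set of currently unstable clique vertices $v_j$ and topple all of them simultaneously; stop after the first $i$ (call it $k$) at which the resulting configuration is stable. Set $q'_i=|Q'_i|$, $p'_i=|P'_i|$ and $\mathsf{topple}_{ITC}(c)=(q'_1,p'_1,\ldots,q'_k,p'_k)$. The pair $[(q'_1,\ldots,q'_k),(p'_1,\ldots,p'_k)]$ is the ITC-toppling sequence of $c$ (of length $k$). $\mathsf{ITC}_{n,d,k}$ is the set of all ITC-toppling sequences of length $k$ of configurations in $\mathsf{SortedRec}(S_{n,d})$, and $\mathsf{ITC}_{n,d}=\bigcup_{k\geq1}\mathsf{ITC}_{n,d,k}$. *)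

(* Defs.v *)
From HB Require Import structures.
From mathcomp Require Import all_boot.
From mathcomp Require Import boolp classical_sets.

Set Implicit Arguments.
Unset Strict Implicit.
Unset Printing Implicit Defensive.

(* A graph with a distinguished sink is a relation [e] on [option T]: the sink
   is [None] and the non-sink vertices are the [Some v]. *)

Definition config (T : finType) := {ffun T -> nat}.

Definition deg (T : finType) (e : rel (option T)) (u : option T) : nat :=
  #|[set v | e u v]|.

Definition unstable (T : finType) (e : rel (option T)) (c : config T) (v : T) :
  bool := deg e (Some v) <= c v.

Definition stable (T : finType) (e : rel (option T)) (c : config T) : bool :=
  [forall v, ~~ unstable e c v].

(* Simultaneous toppling of all the vertices of [A].  The subtraction is the
   truncated one; below, a non-sink vertex is toppled only when it is unstable,
   and then no truncation takes place. *)
Definition topple (T : finType) (e : rel (option T)) (c : config T)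
    (A : {set option T}) : config T :=
  [ffun v => c v - (if Some v \in A then deg e (Some v) else 0)
             + #|[set u in A | e u (Some v)]|].

Definition topple_seq (T : finType) (e : rel (option T)) (c : config T)
    (us : seq (option T)) : config T :=
  foldl (fun c u => topple e c [set u]) c us.

(* The ordering of all vertices is [None :: map Some us]; the entry [v] of [us]
   is to be unstable once the sink and the vertices before [v] have toppled. *)
Definition recurrent (T : finType) (e : rel (option T)) (c : config T) : Prop :=
  stable e c /\
  exists2 us : seq T, perm_eq us (enum T) &
    forall (us1 us2 : seq T) (v : T), us = us1 ++ v :: us2 ->
      unstable e (topple_seq e c (None :: map Some us1)) v.

(* In the complete split graph, [inl i] is the clique vertex v_{i+1} and [inr j]
   is the independent vertex w_{j+1}. *)
Notation split_vertex n d := ('I_n + 'I_d)%type.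

Definition is_indep (n d : nat) (u : option (split_vertex n d)) : bool :=
  if u is Some (inr _) then true else false.

Definition split_adj (n d : nat) : rel (option (split_vertex n d)) :=
  fun u v => (u != v) && ~~ (is_indep u && is_indep v).

Definition sorted_rec (n d : nat) (c : config (split_vertex n d)) : Prop :=
  [/\ recurrent (@split_adj n d) c,
      forall i j : 'I_n, i <= j -> c (inl j) <= c (inl i) &
      forall i j : 'I_d, i <= j -> c (inr j) <= c (inr i)].

Definition unstable_indep (n d : nat) (c : config (split_vertex n d)) :
  {set split_vertex n d} :=
  [set v | is_indep (Some v) && unstable (@split_adj n d) c v].

Definition unstable_clique (n d : nat) (c : config (split_vertex n d)) :
  {set split_vertex n d} :=
  [set v | ~~ is_indep (Some v) && unstable (@split_adj n d) c v].

Definition topple_indep (n d : nat) (c : config (split_vertex n d)) :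
  config (split_vertex n d) :=
  topple (@split_adj n d) c [set Some v | v in unstable_indep c].

Definition topple_clique (n d : nat) (c : config (split_vertex n d)) :
  config (split_vertex n d) :=
  topple (@split_adj n d) c [set Some v | v in unstable_clique c].

(* The configuration after the sink and then [i] full rounds have toppled. *)
Definition itc_config (n d : nat) (c : config (split_vertex n d)) (i : nat) :
  config (split_vertex n d) :=
  iter i (fun c' => topple_clique (topple_indep c'))
       (topple (@split_adj n d) c [set None]).

(* Rounds are numbered from 0 here: [itc_Q c i] and [itc_P c i] are the sets
   Q'_{i+1} and P'_{i+1}. *)
Definition itc_Q (n d : nat) (c : config (split_vertex n d)) (i : nat) :
  {set split_vertex n d} := unstable_indep (itc_config c i).

Definition itc_P (n d : nat) (c : config (split_vertex n d)) (i : nat) :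
  {set split_vertex n d} := unstable_clique (topple_indep (itc_config c i)).

(* At least one round always takes place, so the stability of [itc_config c 0]
   is not examined. *)
Definition itc_length (n d : nat) (c : config (split_vertex n d)) (k : nat) :
  Prop :=
  [/\ 0 < k, stable (@split_adj n d) (itc_config c k) &
      forall i, 0 < i < k -> ~~ stable (@split_adj n d) (itc_config c i)].

Definition ITC_len (n d k : nat) : set (seq nat * seq nat) :=
  [set s | exists c : config (split_vertex n d),
     [/\ sorted_rec c, itc_length c k &
         s = (mkseq (fun i => #|itc_Q c i|) k,
              mkseq (fun i => #|itc_P c i|) k)]]%classic.

Definition ITC (n d : nat) : set (seq nat * seq nat) :=
  (\bigcup_(k in [set k | 1 <= k]) ITC_len n d k)%classic.

(* Main.v *)
Require Import Defs.
From HB Require Import structures.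
From mathcomp Require Import all_boot.
From mathcomp Require Import boolp classical_sets.
From mathcomp Require Import zify.

(** Toppling the sink and all the other neighbours of a vertex returns to it at
    most the grains it lost by toppling once, so in a stable configuration no
    vertex topples twice, and an untoppled vertex is unstable as soon as its
    initial grains and its toppled neighbours together reach its degree.
    Recurrence forces all vertices to topple before the process stops, whence
    the two sums.  A round without clique toppling leaves a stable
    configuration, because the independent vertices are pairwise non-adjacent,
    whence [a_i > 0] for [i < k].  Conversely, given (b, a), give each vertex
    the least number of grains that makes it topple in its prescribed round: since
    [a_i > 0] for [i < k] it cannot topple earlier. *)

Set Implicit Arguments.
Unset Strict Implicit.
Unset Printing Implicit Defensive.

(** * Toppling on a general graph with a sink *)

Section Toppling.
Variables (T : finType) (e : rel (option T)).
Implicit Types (c x : config T) (A B : {set T}) (v : T).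

Definition with_sink A : {set option T} := None |: (Some @: A).

Definition gain A v : nat := #|[set u in with_sink A | e u (Some v)]|.

(* [x] is [c] with the sink and the vertices of [A] toppled once each; the
   equation is free of subtractions. *)
Definition toppled_once c A x : Prop :=
  forall v, x v + (if v \in A then deg e (Some v) else 0) = c v + gain A v.

Lemma some_imset A v : (Some v \in Some @: A) = (v \in A).
Proof. by rewrite mem_imset //; exact: Some_inj. Qed.

Lemma with_sinkE A (u : option T) :
  (u \in with_sink A) = if u is Some v then v \in A else true.
Proof.
case: u => [v|]; rewrite !inE //=; exact: some_imset.
Qed.

Lemma gainE A v :
  gain A v = e None (Some v) + #|[set u in A | e (Some u) (Some v)]|.
Proof.
rewrite /gain (cardsD1 None) inE with_sinkE /=; congr (_ + _).
rewrite -(card_imset _ (@Some_inj _)); apply: eq_card => -[u|].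
  by rewrite some_imset !inE /= some_imset.
by rewrite !inE /=; apply/esym/negbTE/imsetP; case.
Qed.

Lemma gainS A B v : A \subset B -> gain A v <= gain B v.
Proof.
move=> sAB; rewrite !gainE leq_add2l.
apply/subset_leq_card/fintype.subsetP => u.
by rewrite !inE => /andP[/(fintype.subsetP sAB)-> ->].
Qed.

Lemma gainU A B v : [disjoint A & B] ->
  gain (A :|: B) v = gain A v + #|[set u in B | e (Some u) (Some v)]|.
Proof.
move=> dAB; rewrite !gainE -addnA -cardsUI; congr (_ + _).
rewrite [X in _ = _ + X](_ : _ = 0) ?addn0.
  by apply: eq_card => u; rewrite !inE andb_orl.
apply/eqP; rewrite cards_eq0 -finset.subset0; apply/fintype.subsetP => u.
rewrite !inE => /andP[/andP[uA _] /andP[uB _]].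
by rewrite (disjointFr dAB uA) in uB.
Qed.

Lemma gain_setT v : symmetric e -> gain [set: T] v = deg e (Some v).
Proof.
move=> se; apply: eq_card => u; rewrite [LHS]inE [RHS]inE with_sinkE se.
by case: u => [u|] //=; rewrite inE.
Qed.

Lemma topple0 c : topple e c finset.set0 = c.
Proof.
apply/ffunP => v; rewrite ffunE inE subn0.
rewrite (_ : [set u in _ | _] = finset.set0) ?cards0 ?addn0 //.
by apply/setP => u; rewrite !inE.
Qed.

Lemma topple_imset c B v :
  topple e c (Some @: B) v =
  c v - (if v \in B then deg e (Some v) else 0)
  + #|[set u in B | e (Some u) (Some v)]|.
Proof.
rewrite ffunE some_imset; congr (_ + _).
rewrite -(card_imset [set u in B | _] (@Some_inj _)); apply: eq_card => -[u|].
  by rewrite some_imset !inE some_imset.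
rewrite !inE; apply/andP/imsetP => [[/imsetP[] //]|[] //].
Qed.

Lemma toppled_once0 c : toppled_once c finset.set0 (topple e c [set None]).
Proof.
move=> v; rewrite inE addn0 ffunE inE subn0; congr (_ + _).
by apply: eq_card => u; rewrite [LHS]inE [RHS]inE with_sinkE;
  case: u => [u|]; rewrite !inE.
Qed.

(** Disjointness keeps every vertex at one toppling, and instability on [B] makes the truncated
    subtraction in [topple] exact. *)
Lemma toppled_onceU c A x B :
  toppled_once c A x -> [disjoint A & B] -> {in B, forall v, unstable e x v} ->
  toppled_once c (A :|: B) (topple e x (Some @: B)).
Proof.
move=> xA dAB uB v; rewrite topple_imset gainU // addnA -xA inE.
case: (boolP (v \in B)) => vB.
  rewrite (disjointFl dAB vB) /=; have := uB v vB; rewrite /unstable; lia.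
by rewrite orbF; lia.
Qed.

(** If [v] has toppled, its gain is at most that from all vertices, which equals its degree, so it
    holds at most [c v] grains. This turns the dynamics into a static test on the toppled set. *)
Lemma toppled_once_unstable c A x v :
  symmetric e -> stable e c -> toppled_once c A x ->
  unstable e x v = (v \notin A) && (deg e (Some v) <= c v + gain A v).
Proof.
move=> se /forallP/(_ v) sc /(_ v); rewrite /unstable in sc *.
have := gainS v (finset.subsetT A); rewrite gain_setT //.
by case: (boolP (v \in A)) => /= _; lia.
Qed.

(** Truncated subtraction only concerns the toppled vertices, so the count at the untoppled [v] is
    exact whatever the order. *)
Lemma topple_seqE c (us : seq T) v : uniq us -> v \notin us ->
  topple_seq e c (None :: map Some us) v = c v + gain [set u in us] v.
Proof.
elim/last_ind: us => [|us u IH] /= in v *.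
  move=> _ _; have := toppled_once0 c v; rewrite inE addn0 => ->.
  by congr (_ + gain _ _); apply/setP => u; rewrite !inE.
rewrite rcons_uniq => /andP[uus Uus].
rewrite mem_rcons inE negb_or => /andP[vu vus].
rewrite map_rcons /topple_seq foldl_rcons -/(topple_seq e c (None :: _)).
rewrite -imset_set1 topple_imset inE (negbTE vu) subn0 IH // -addnA -gainU.
  congr (_ + gain _ _); apply/setP => w.
  by rewrite !inE mem_rcons inE orbC.
by rewrite disjoint_sym disjoints1 inE.
Qed.

(** Take the first vertex of the recurrence order outside [A]. Its predecessors all lie in [A], so
    by monotonicity of [gain] it would be unstable in [x]. *)
Lemma recurrent_toppled_setT c A x : recurrent e c ->
  stable e x -> toppled_once c A x -> A = [set: T].
Proof.
move=> [sc [us pus rec]] sx xA; apply/setP => v0; rewrite [RHS]inE.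
suff /allP allA : all (mem A) us.
  by apply: allA; rewrite (perm_mem pus) mem_enum.
have Uus : uniq us by rewrite (perm_uniq pus) enum_uniq.
apply/negPn/negP => nall.
have hasN : has (fun v => v \notin A) us by rewrite has_predC.
case: (split_find hasN) Uus rec => v us1 us2 vA; rewrite has_predC negbK.
move=> us1A; rewrite cat_uniq rcons_uniq => /andP[/andP[vus1 Uus1] _].
rewrite cat_rcons => /(_ us1 us2 v erefl); rewrite /unstable topple_seqE //.
have := forallP sx v; rewrite /unstable; have := xA v.
rewrite (negbTE vA) addn0 => -> lt le.
have /(gainS v) : [set u in us1] \subset A.
  by apply/fintype.subsetP => u; rewrite inE => /(allP us1A).
lia.
Qed.

(** Sorting the vertices by [r] puts all those of smaller rank before [v]; any others before it only
    add grains. *)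
Lemma recurrent_rank c (r : T -> nat) : stable e c ->
  (forall v, deg e (Some v) <= c v + gain [set u | r u < r v] v) ->
  recurrent e c.
Proof.
move=> sc rP; split=> //; set s := relpre r leq.
exists (sort s (enum T)); first by rewrite perm_sort.
move=> us1 us2 v us_eq.
have : uniq (us1 ++ v :: us2) by rewrite -us_eq sort_uniq enum_uniq.
have tot : total s by move=> x y; exact: leq_total.
have tr : transitive s by move=> x y z; exact: leq_trans.
have : sorted s (us1 ++ v :: us2) by rewrite -us_eq sort_sorted.
rewrite sorted_pairwise // pairwise_cat /= => /and4P[_ _ /allP vus2 _].
rewrite cat_uniq /= => /and3P[Uus1]; rewrite negb_or => /andP[vus1 _] _.
rewrite /unstable topple_seqE //; apply: (leq_trans (rP v)).
rewrite leq_add2l; apply/gainS/fintype.subsetP => u; rewrite !inE => ruv.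
have : u \in us1 ++ v :: us2 by rewrite -us_eq mem_sort mem_enum.
rewrite mem_cat inE => /or3P[//|/eqP uv|/vus2]; first by rewrite uv ltnn in ruv.
by rewrite /s /= leqNgt ruv.
Qed.

End Toppling.

(** * Degrees and gains in the complete split graph *)

Section CompleteSplitGraph.
Variables n d : nat.
Local Notation V := (split_vertex n d).
Local Notation adj := (@split_adj n d).
Implicit Types (c x : config V) (A : {set V}) (v : V).

Lemma split_adj_sym : symmetric adj.
Proof.
by move=> u v; rewrite /split_adj eq_sym [is_indep u && _]andbC.
Qed.

Lemma gain_clique A (i : 'I_n) : inl i \notin A -> gain adj A (inl i) = #|A|.+1.
Proof.
move=> iA; rewrite gainE /= add1n; congr _.+1; apply: eq_card => u.
rewrite inE /split_adj /= andbF /= andbT.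
case: (boolP (u \in A)) => //= uA; apply/eqP => -[ui].
by rewrite -ui uA in iA.
Qed.

Lemma gain_indep A (j : 'I_d) :
  gain adj A (inr j) = #|[set v in A | ~~ is_indep (Some v)]|.+1.
Proof.
rewrite gainE /= add1n; congr _.+1; apply: eq_card => -[i|i]; rewrite !inE //=.
by rewrite /split_adj /= andbF.
Qed.

(** The shape of every toppled set of the configuration constructed in the converse direction. *)
Definition segment (p q : nat) : {set V} :=
  [set v : V | match v with inl i => i < p | inr j => j < q end].

Lemma card_segment p q : p <= n -> q <= d -> #|segment p q| = p + q.
Proof.
move=> lp lq; rewrite -sum1_card big_sumType /=; congr (_ + _).
  rewrite -[RHS]card_ord -sum1_card (big_ord_widen n (fun=> 1)) //.
  by apply: eq_bigl => i; rewrite inE.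
rewrite -[RHS]card_ord -sum1_card (big_ord_widen d (fun=> 1)) //.
by apply: eq_bigl => i; rewrite inE.
Qed.

Lemma card_segment_clique p q : p <= n ->
  #|[set v in segment p q | ~~ is_indep (Some v)]| = p.
Proof.
move=> lp; rewrite -[RHS]addn0 -card_segment //.
by apply: eq_card => -[i|i]; rewrite !inE ?andbT ?andbF.
Qed.

Lemma card_segment_indep p q : q <= d ->
  #|[set v in segment p q | is_indep (Some v)]| = q.
Proof.
move=> lq; rewrite -[RHS]add0n -card_segment //.
by apply: eq_card => -[i|i]; rewrite !inE ?andbT ?andbF.
Qed.

Lemma segmentT : segment n d = [set: V].
Proof. by apply/setP => -[i|i]; rewrite !inE ltn_ord. Qed.

Lemma deg_clique (i : 'I_n) : deg adj (Some (inl i)) = n + d.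
Proof.
rewrite /deg (_ : [set v | _] = [set~ Some (inl i)]).
  by rewrite cardsC1 card_option card_sum !card_ord.
by apply/setP => u; rewrite !inE /split_adj /= andbT eq_sym.
Qed.

Lemma deg_indep (j : 'I_d) : deg adj (Some (inr j)) = n.+1.
Proof.
rewrite -gain_setT; last exact: split_adj_sym.
by rewrite gain_indep -segmentT card_segment_clique.
Qed.

(** * The ITC process started from a stable configuration *)

Fixpoint itc_toppled c i : {set V} :=
  if i is i'.+1 then itc_toppled c i' :|: itc_Q c i' :|: itc_P c i'
  else finset.set0.

(** The two claims alternate in the induction: an independent half round leads from the first to the
    second, a clique half round from the second to the first at [i.+1]. *)
Lemma itc_toppled_once c i : stable adj c ->
  toppled_once adj c (itc_toppled c i) (itc_config c i) /\
  toppled_once adj c (itc_toppled c i :|: itc_Q c i)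
    (topple_indep (itc_config c i)).
Proof.
move=> sc.
have disj A x (B : {set V}) : toppled_once adj c A x ->
    {in B, forall v, unstable adj x v} -> [disjoint A & B].
  move=> xA uB; rewrite disjoint_sym disjoint_subset.
  apply/fintype.subsetP => v /uB.
  by rewrite (toppled_once_unstable _ split_adj_sym sc xA) => /andP[].
have indep A x : toppled_once adj c A x ->
    toppled_once adj c (A :|: unstable_indep x) (topple_indep x).
  move=> xA; have uB : {in unstable_indep x, forall v, unstable adj x v}.
    by move=> v; rewrite inE => /andP[].
  by apply: toppled_onceU => //; apply: disj xA uB.
have clique A x : toppled_once adj c A x ->
    toppled_once adj c (A :|: unstable_clique x) (topple_clique x).
  move=> xA; have uB : {in unstable_clique x, forall v, unstable adj x v}.
    by move=> v; rewrite inE => /andP[].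
  by apply: toppled_onceU => //; apply: disj xA uB.
elim: i => [|i [_ IH]].
  by have t0 := toppled_once0 adj c; split=> //; exact: indep.
by have := clique _ _ IH => t; split=> //; exact: indep.
Qed.

Lemma mem_itc_Q c i v : stable adj c ->
  (v \in itc_Q c i) = [&& is_indep (Some v), v \notin itc_toppled c i &
    deg adj (Some v) <= c v + gain adj (itc_toppled c i) v].
Proof.
move=> sc; have [t _] := itc_toppled_once i sc.
by rewrite inE (toppled_once_unstable _ split_adj_sym sc t).
Qed.

Lemma mem_itc_P c i v : stable adj c ->
  (v \in itc_P c i) = [&& ~~ is_indep (Some v), v \notin itc_toppled c i &
    deg adj (Some v) <= c v + gain adj (itc_toppled c i :|: itc_Q c i) v].
Proof.
move=> sc; have [_ t] := itc_toppled_once i sc.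
rewrite inE (toppled_once_unstable _ split_adj_sym sc t) inE negb_or.
(* [itc_Q c i] holds only independent vertices, so for a clique vertex avoiding the union means
   avoiding [itc_toppled c i]. *)
by rewrite (mem_itc_Q _ _ sc); case: (is_indep _); rewrite ?andbT.
Qed.

(** Each [itc_Q c j] avoids the vertices toppled before it, so these sets are disjoint and their
    sizes add up. *)
Lemma sum_card_itc_Q c i : stable adj c ->
  \sum_(j < i) #|itc_Q c j| = #|[set v in itc_toppled c i | is_indep (Some v)]|.
Proof.
move=> sc; elim: i => [|i IH].
  rewrite big_ord0; apply/esym/eqP; rewrite cards_eq0.
  by apply/eqP/setP => v; rewrite !inE.
rewrite big_ord_recr /= IH -cardsUI [X in _ + X](_ : _ = 0) ?addn0.
  apply: eq_card => v.
  rewrite [RHS]inE !finset.in_setU mem_itc_Q // mem_itc_P // inE.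
  by case: v => j; rewrite /= !(andbT, andbF, orbF).
apply/eqP; rewrite cards_eq0; apply/eqP/setP => v.
rewrite finset.in_setI mem_itc_Q // !inE.
by case: (v \in _); rewrite /= ?andbF.
Qed.

Lemma sum_card_itc_P c i : stable adj c ->
  \sum_(j < i) #|itc_P c j| =
  #|[set v in itc_toppled c i | ~~ is_indep (Some v)]|.
Proof.
move=> sc; elim: i => [|i IH].
  rewrite big_ord0; apply/esym/eqP; rewrite cards_eq0.
  by apply/eqP/setP => v; rewrite !inE.
rewrite big_ord_recr /= IH -cardsUI [X in _ + X](_ : _ = 0) ?addn0.
  apply: eq_card => v.
  rewrite [RHS]inE !finset.in_setU mem_itc_Q // mem_itc_P // inE.
  by case: v => j; rewrite /= !(andbT, andbF, orbF).
apply/eqP; rewrite cards_eq0; apply/eqP/setP => v.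
rewrite finset.in_setI mem_itc_P // !inE.
by case: (v \in _); rewrite /= ?andbF.
Qed.

Lemma topple_indep_id x : unstable_indep x = finset.set0 -> topple_indep x = x.
Proof. by rewrite /topple_indep => ->; rewrite imset0 topple0. Qed.

Lemma topple_clique_id x :
  unstable_clique x = finset.set0 -> topple_clique x = x.
Proof. by rewrite /topple_clique => ->; rewrite imset0 topple0. Qed.

Lemma itc_configS c i :
  itc_config c i.+1 = topple_clique (topple_indep (itc_config c i)).
Proof. by []. Qed.

Lemma stable_unstable_indep x : stable adj x -> unstable_indep x = finset.set0.
Proof.
by move=> /forallP sx; apply/setP => v; rewrite !inE (negbTE (sx v)) andbF.
Qed.

Lemma stable_unstable_clique x :
  stable adj x -> unstable_clique x = finset.set0.
Proof.
by move=> /forallP sx; apply/setP => v; rewrite !inE (negbTE (sx v)) andbF.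
Qed.

Lemma itc_stable_QP0 c i : stable adj (itc_config c i) ->
  itc_Q c i = finset.set0 /\ itc_P c i = finset.set0.
Proof.
move=> sx; have Q0 := stable_unstable_indep sx; split=> //.
by rewrite /itc_P topple_indep_id // stable_unstable_clique.
Qed.

Lemma itc_QP0_config c i : itc_Q c i = finset.set0 -> itc_P c i = finset.set0 ->
  itc_config c i.+1 = itc_config c i.
Proof.
move=> Q0; rewrite itc_configS /itc_P => P0.
by rewrite topple_clique_id // topple_indep_id.
Qed.

(* Independent vertices are pairwise non-adjacent, so toppling [Q'_i] makes no
   further independent vertex unstable. *)
Lemma itc_P0_stable c i : stable adj c -> itc_P c i = finset.set0 ->
  stable adj (itc_config c i.+1).
Proof.
move=> sc P0; have [_ t] := itc_toppled_once i sc.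
rewrite itc_configS topple_clique_id //; apply/forallP => v; apply/negP.
case: v => [v|v] uv.
  have : inl v \in itc_P c i by rewrite inE uv.
  by rewrite P0 inE.
move: uv; rewrite (toppled_once_unstable _ split_adj_sym sc t) inE negb_or.
rewrite (mem_itc_Q _ _ sc) /= => /andP[/andP[-> /negP nQ] le]; apply: nQ.
apply: (leq_trans le); rewrite leq_add2l !gain_indep ltnS.
apply/subset_leq_card/fintype.subsetP => u.
rewrite inE finset.in_setU mem_itc_Q // inE.
by case: (is_indep _); rewrite ?andbF ?orbF.
Qed.

End CompleteSplitGraph.

(** * Realising a prescribed pair of sequences *)

Section Realisation.

Definition psum (f : nat -> nat) (i : nat) : nat := \sum_(j < i) f j.

Lemma psumS f i : psum f i.+1 = psum f i + f i.
Proof. exact: big_ord_recr. Qed.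

Lemma leq_psum f i j : i <= j -> psum f i <= psum f j.
Proof.
by move=> /subnK <-; elim: (j - i) => // m IH; rewrite addSn psumS; lia.
Qed.

(** The naturals are cut into consecutive blocks of lengths [f 0, ..., f k.-1], and the block
    containing [j] is returned; the value is [k] if [j] lies beyond them all. *)
Definition block (f : nat -> nat) (k j : nat) : nat :=
  find (fun i => j < psum f i.+1) (iota 0 k).

Lemma block_lt f k j : j < psum f k -> block f k j < k.
Proof.
case: k => [|k]; first by rewrite /psum big_ord0.
move=> jk; rewrite -[X in _ < X](size_iota 0) -has_find.
by apply/hasP; exists k => //; rewrite mem_iota /= add0n.
Qed.

Lemma block_le f k j i : j < psum f k -> i < k ->
  (block f k j <= i) = (j < psum f i.+1).
Proof.
move=> jk ik; have bk := block_lt jk; apply/idP/idP => [le|lt].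
  have : j < psum f (block f k j).+1.
    have := @nth_find _ 0 (fun i => j < psum f i.+1) (iota 0 k).
    by rewrite nth_iota // add0n; apply; rewrite has_find size_iota.
  by move/leq_trans; apply; apply: leq_psum.
rewrite leqNgt; apply/negP => /(before_find 0).
by rewrite nth_iota // add0n lt.
Qed.

Lemma block_gt f k j i : j < psum f k -> i <= k ->
  (block f k j < i) = (j < psum f i).
Proof.
case: i => [|i] jk ik; first by rewrite /psum big_ord0.
by rewrite ltnS block_le.
Qed.

Lemma leq_block f k i j : i <= j -> j < psum f k -> block f k i <= block f k j.
Proof.
move=> ij jk; rewrite block_le ?block_lt //; last exact: leq_ltn_trans jk.
by apply: leq_ltn_trans ij _; rewrite -(block_le jk) // block_lt.
Qed.

Variables (n d k : nat) (b a : nat -> nat).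
Hypothesis k_gt0 : 0 < k.
Hypotheses (sum_b : psum b k = d) (sum_a : psum a k = n).
Hypothesis a_gt0 : forall i, i < k.-1 -> 0 < a i.
Hypothesis ba_gt0 : 0 < b k.-1 + a k.-1.

Local Notation V := (split_vertex n d).
Local Notation adj := (@split_adj n d).

(* A vertex of the (i+1)-st block carries just enough grains to become unstable
   once the sink, the first i clique blocks and the first i (clique vertices:
   i+1) independent blocks have toppled. *)
Definition itc_realisation : config V :=
  [ffun v : V => match v with
    | inl j => (n + d).-1 - (psum a (block a k j) + psum b (block a k j).+1)
    | inr j => n - psum a (block b k j)
    end].

Local Notation c := itc_realisation.

(** Only the last clique block may be empty, and [j < k] keeps it out of the sum. This strictness
    separates the rounds. *)
Lemma psum_a_lt i j : i < j -> j < k -> psum a i < psum a j.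
Proof.
move=> ij jk; apply: leq_trans (leq_psum a ij).
by rewrite psumS -addn1 leq_add2l a_gt0; lia.
Qed.

Lemma psum_a_le_n i : i <= k -> psum a i <= n.
Proof. by rewrite -sum_a; exact: leq_psum. Qed.

Lemma psum_b_le_d i : i <= k -> psum b i <= d.
Proof. by rewrite -sum_b; exact: leq_psum. Qed.

Lemma ord_psum_a (j : 'I_n) : j < psum a k.
Proof. by rewrite sum_a. Qed.

Lemma ord_psum_b (j : 'I_d) : j < psum b k.
Proof. by rewrite sum_b. Qed.

(** The [.+1] on the left is the grain from the sink. From its own block on, monotone partial sums
    make the vertex unstable; before it, strict growth of [psum a] leaves it at least one grain
    short. *)
Lemma realisation_clique (j : 'I_n) i : i < k ->
  (n + d <= c (inl j) + (psum a i + psum b i.+1).+1) = (j < psum a i.+1).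
Proof.
move=> ik; rewrite ffunE -(block_le (ord_psum_a j)) //.
have mk := block_lt (ord_psum_a j); set m := block a k j in mk *.
(* With [j < n] and [psum b m.+1 <= d], this makes the subtraction defining [c] exact. *)
have : psum a m <= j.
  by rewrite leqNgt -(block_gt (ord_psum_a j) (ltnW mk)) ltnn.
have := psum_b_le_d mk; have := ltn_ord j.
case: (leqP m i) => [mi|im].
  by have := leq_psum a mi; have := leq_psum b (mi : m.+1 <= i.+1); lia.
have := psum_a_lt im mk; have := leq_psum b (leqW im); lia.
Qed.

Lemma realisation_indep (j : 'I_d) i : i < k ->
  (n.+1 <= c (inr j) + (psum a i).+1) = (j < psum b i.+1).
Proof.
move=> ik; rewrite ffunE -(block_le (ord_psum_b j)) //.
have mk := block_lt (ord_psum_b j); set m := block b k j in mk *.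
have := psum_a_le_n (ltnW mk).
case: (leqP m i) => [mi|im]; first by have := leq_psum a mi; lia.
by have := psum_a_lt im mk; lia.
Qed.

Lemma realisation_stable : stable adj c.
Proof.
apply/forallP => -[j|j]; have := ltn_ord j;
  by rewrite /unstable ffunE ?deg_clique ?deg_indep; lia.
Qed.

Lemma realisation_recurrent : recurrent adj c.
Proof.
(* [r] numbers the half rounds: even values for independent blocks, odd ones for clique blocks. *)
pose r (v : V) := match v with
  | inl j => (block a k j).*2.+1 | inr j => (block b k j).*2 end.
apply: (@recurrent_rank _ _ _ r) => [|[j|j]]; first exact: realisation_stable.
  have mk := block_lt (ord_psum_a j); set m := block a k j in mk.
  have -> : [set u | r u < r (inl j)] = segment n d (psum a m) (psum b m.+1).
    apply/setP => -[i|i]; rewrite !inE /= -/m.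
      by rewrite -(block_gt (ord_psum_a i) (ltnW mk)); lia.
    by rewrite -(block_le (ord_psum_b i)) //; lia.
  rewrite deg_clique gain_clique.
    rewrite card_segment ?psum_b_le_d ?psum_a_le_n ?(ltnW mk) //.
    by rewrite realisation_clique // -(block_le (ord_psum_a j)).
  by rewrite inE -(block_gt (ord_psum_a j) (ltnW mk)) ltnn.
have mk := block_lt (ord_psum_b j); set m := block b k j in mk.
have -> : [set u | r u < r (inr j)] = segment n d (psum a m) (psum b m).
  apply/setP => -[i|i]; rewrite !inE /= -/m.
    by rewrite -(block_gt (ord_psum_a i) (ltnW mk)); lia.
  by rewrite -(block_gt (ord_psum_b i) (ltnW mk)); lia.
rewrite deg_indep gain_indep card_segment_clique ?psum_a_le_n ?(ltnW mk) //.
by rewrite realisation_indep // -(block_le (ord_psum_b j)).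
Qed.

Lemma realisation_sorted : sorted_rec c.
Proof.
split; first exact: realisation_recurrent.
  move=> i j ij; rewrite !ffunE leq_sub2l //.
  have le := leq_block ij (ord_psum_a j).
  by rewrite leq_add ?leq_psum.
move=> i j ij; rewrite !ffunE leq_sub2l //.
by have le := leq_block ij (ord_psum_b j); rewrite leq_psum.
Qed.

Lemma realisation_toppled i : i <= k ->
  itc_toppled c i = segment n d (psum a i) (psum b i).
Proof.
have sc := realisation_stable; elim: i => [_|i IH ik].
  by apply/setP => -[j|j]; rewrite !inE /psum big_ord0.
have Ai := IH (ltnW ik).
have AQ : itc_toppled c i :|: itc_Q c i = segment n d (psum a i) (psum b i.+1).
  apply/setP => v; rewrite inE mem_itc_Q // Ai; case: v => j.
    by rewrite !inE orbF.
  rewrite deg_indep gain_indep card_segment_clique ?psum_a_le_n ?(ltnW ik) //.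
  by rewrite realisation_indep // !inE psumS /=; lia.
apply/setP => v /=; rewrite inE mem_itc_P // AQ Ai; case: v => j.
  rewrite !inE /=; case: ltnP => /= ji; first by rewrite psumS; lia.
  rewrite deg_clique gain_clique; last by rewrite inE -leqNgt.
  rewrite card_segment ?psum_a_le_n ?psum_b_le_d ?(ltnW ik) //.
  by rewrite realisation_clique.
by rewrite !inE orbF.
Qed.

(** All partial sums agree, since both count the independent vertices of one segment; consecutive
    ones then cancel. *)
Lemma realisation_Q i : i < k -> #|itc_Q c i| = b i.
Proof.
have sum_Q j : j <= k -> psum (fun l => #|itc_Q c l|) j = psum b j.
  move=> jk; rewrite /psum sum_card_itc_Q; last exact: realisation_stable.
  by rewrite realisation_toppled // card_segment_indep // psum_b_le_d.
by move=> ik; have := sum_Q _ ik; rewrite !psumS (sum_Q _ (ltnW ik)) => /addnI.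
Qed.

Lemma realisation_P i : i < k -> #|itc_P c i| = a i.
Proof.
have sum_P j : j <= k -> psum (fun l => #|itc_P c l|) j = psum a j.
  move=> jk; rewrite /psum sum_card_itc_P; last exact: realisation_stable.
  by rewrite realisation_toppled // card_segment_clique // psum_a_le_n.
by move=> ik; have := sum_P _ ik; rewrite !psumS (sum_P _ (ltnW ik)) => /addnI.
Qed.

Lemma realisation_length : itc_length c k.
Proof.
have sc := realisation_stable.
split=> // [|i /andP[i0 ik]].
  have [t _] := itc_toppled_once k sc; apply/forallP => v.
  rewrite (toppled_once_unstable _ (@split_adj_sym n d) sc t).
  by rewrite realisation_toppled // sum_a sum_b segmentT inE.
(* Stability before round [i] makes that round empty, which [a_gt0] forbids for [i < k.-1] and
   [ba_gt0] for [i = k.-1]. *)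
apply/negP => /itc_stable_QP0[Q0 P0].
have b0 : b i = 0 by rewrite -realisation_Q // Q0 cards0.
have a0 : a i = 0 by rewrite -realisation_P // P0 cards0.
have [/a_gt0|kj] := ltnP i k.-1; first by rewrite a0.
have ki : k.-1 = i by lia.
by move: ba_gt0; rewrite ki b0 a0.
Qed.

Lemma realisation_ITC : ITC n d (mkseq b k, mkseq a k).
Proof.
exists k => //=; exists c; split.
- exact: realisation_sorted.
- exact: realisation_length.
- congr pair; apply: (@eq_from_nth _ 0); rewrite !size_mkseq // => i ik.
    by rewrite !nth_mkseq // realisation_Q.
  by rewrite !nth_mkseq // realisation_P.
Qed.

End Realisation.

(** * The two inclusions *)

Lemma sumn_mkseq f k : sumn (mkseq f k) = psum f k.
Proof.
by rewrite sumnE big_map -[X in iota 0 X]subn0 -/(index_iota 0 k) big_mkord.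
Qed.

(** An empty last round would mean stability already after [k.-1] rounds; [itc_length] excludes this
    only when [0 < k.-1], whence the guard [1 < k]. *)
Lemma ITC_len_sound n d k s : ITC_len n d k s ->
  exists b a, [/\ s = (mkseq b k, mkseq a k),
    psum b k = d, psum a k = n,
    forall i, i < k.-1 -> 0 < a i &
    1 < k -> 0 < b k.-1 + a k.-1].
Proof.
move=> [c [[rec _ _] [k0 sk uk] ->]]; have [sc _] := rec.
have [t _] := itc_toppled_once k sc.
have AT := recurrent_toppled_setT rec sk t.
exists (fun i => #|itc_Q c i|), (fun i => #|itc_P c i|); split=> //.
- by rewrite /psum sum_card_itc_Q // AT -segmentT card_segment_indep.
- by rewrite /psum sum_card_itc_P // AT -segmentT card_segment_clique.
- move=> i ik; rewrite lt0n cards_eq0; apply/eqP => P0.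
  have /negP : ~~ stable (@split_adj n d) (itc_config c i.+1) by apply: uk; lia.
  by apply; exact: itc_P0_stable.
- move=> k1; rewrite lt0n addn_eq0 !cards_eq0.
  apply/negP => /andP[/eqP Q0 /eqP P0].
  have /negP : ~~ stable (@split_adj n d) (itc_config c k.-1) by apply: uk; lia.
  by apply; rewrite -itc_QP0_config // prednK.
Qed.

Theorem theorem2p7 (n d : nat) (hn : 1 <= n) :
  ITC n d =
  ([set ([:: d], [:: n])] `|`
   \bigcup_(k in [set k | 2 <= k])
     [set s : seq nat * seq nat | exists b a : seq nat,
        s = (b, a) /\
        [/\ size b = k /\ sumn b = d,
            size a = k /\ sumn a = n,
            forall i, i < k.-1 -> 0 < nth 0 a i &
            0 < nth 0 b k.-1 + nth 0 a k.-1]])%classic.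
Proof.
apply/seteqP; split=> s.
  move=> [k /= k0 /ITC_len_sound[b [a [-> sb sa agt bagt]]]].
  case: k k0 sb sa agt bagt => // -[|k] _ sb sa agt bagt.
    by left; rewrite -sb -sa /psum !big_ord1.
  right; exists k.+2 => //=; exists (mkseq b k.+2), (mkseq a k.+2).
  rewrite !size_mkseq !sumn_mkseq !nth_mkseq //; split=> //.
  split=> //; last exact: bagt.
  by move=> i ik; rewrite nth_mkseq ?agt // ltnS ltnW.
move=> [->|[k /= k2 [b [a [-> [[kb sb] [ka sa] agt bagt]]]]]].
  (* For a single round the positivity condition reads [0 < d + n], which is where [hn] enters. *)
  apply: (@realisation_ITC n d 1 (fun=> d) (fun=> n)) => //.
  - by rewrite /psum big_ord1.
  - by rewrite /psum big_ord1.
  - by rewrite ltn_addl.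
(* Both lists become functions through [nth 0]; the default is never read at indices below [k]. *)
rewrite -[b](mkseq_nth 0) -[a](mkseq_nth 0) kb ka.
apply: realisation_ITC => //; first exact: ltnW.
- by rewrite -sumn_mkseq -kb mkseq_nth.
- by rewrite -sumn_mkseq -ka mkseq_nth.
Qed.
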